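(* Consider the saturated microgrid model, robust feasibility and operation cost $J$ defined in the context, with non-negative droop gains $\chi_{\mathrm t},\chi_{\mathrm s},\chi_{\mathrm r}$. For any initial conditions $x_{\mathrm s,0}\in[x^{\min},x^{\max}]$, $\delta_{\mathrm t,0}\in\{0,1\}^T$ and any robustly feasible control $(\boldsymbol\delta_{\mathrm t},\mathbf u)$, the worst-case operation cost is attained at the disturbance realization $\mathbf w=\mathbf w^{\min}$, i.e. $$\max_{\mathbf w\in[\mathbf w^{\min},\mathbf w^{\max}]}J\big|_{\mathbf w}=J\big|_{\mathbf w=\mathbf w^{\min}},$$ where $J|_{\mathbf w}$ is the operation cost of the unit powers $\mathbf p$ resulting from the model under the given initial conditions, the given control and the disturbance $\mathbf w$.
   Context: Conventions. All comparisons, minima, maxima, absolute values of vectors or matrices are elementwise; $[a,b]$ denotes the box $\{z: a\le z\le b\}$; $\mathbf 1^{\mathsf T}z=\sum_i z_i$. For $\delta\in\{0,1\}$, $z\in\mathbb R$: $\delta\wedge z=z$ if $\delta=1$ and $0$ if $\delta=0$ (elementwise for vectors). For $a\le b$: $\mathrm{sat}(a,z,b)=a$ if $z<a$, $=z$ if $z\in[a,b]$, $=b$ if $z>b$ (elementwise for vectors). Data. $T,S,R,D$ are the numbers of conventional units, storage units, renewable units and loads; $N_p\in\mathbb N$ is the prediction horizon, $\mathrm T_{\mathrm s}>0$ the sampling time, $k$ a fixed time instant. Droop gains $\chi_{\mathrm t}\in\mathbb R_{\ge0}^T$, $\chi_{\mathrm s}\in\mathbb R_{\ge0}^S$, $\chi_{\mathrm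 r}\in\mathbb R_{\ge0}^R$. Power limits $p_{\mathrm t}^{\min}\in\mathbb R_{\ge0}^T$, $p_{\mathrm s}^{\min}\in\mathbb R_{<0}^S$, $p_{\mathrm r}^{\min}\in\mathbb R_{\ge0}^R$, $p_{\mathrm t}^{\max}\in\mathbb R_{>0}^T$, $p_{\mathrm s}^{\max}\in\mathbb R_{>0}^S$ with $p_{\mathrm t}^{\min}\le p_{\mathrm t}^{\max}$. Energy limits $x^{\min}\in\mathbb R_{\ge0}^S$, $x^{\max}\in\mathbb R_{>0}^S$, $x^{\min}\le x^{\max}$. Set-point limits $u^{\min}\le u^{\max}$ in $\mathbb R^{T+S+R}$. Variables, for $j=1,\dots,N_p$. Set-points $u(k+j)=(u_{\mathrm t},u_{\mathrm s},u_{\mathrm r})(k+j)\in\mathbb R^{T}\times\mathbb R^S\times\mathbb R^R$; switch statuses $\delta_{\mathrm t}(k+j)\in\{0,1\}^T$; disturbances $w(k+j)=(w_{\mathrm r},w_{\mathrm d})(k+j)$ with available renewable infeed $w_{\mathrm r}\in\mathbb R_{\ge0}^R$ and load $w_{\mathrm d}\in\mathbb R_{\le0}^D$; unit powers $p(k+j)=(p_{\mathrm t},p_{\mathrm s},p_{\mathrm r})(k+j)$; stored energies $x(k+j)\in\mathbb R^S$; auxiliary free scalar $\rho(k+j)\in\mathbb R$. Bold symbols $\boldsymbol\delta_{\mathrm t},\mathbf u,\mathbf w,\mathbf p$ denote the matrices whose columns are the values at $k+1,\dots,k+N_p$; $\mathbf w^{\min}\le\mathbf w^{\max}$ are given disturbance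 bounds (also of this sign type), and the renewable bounds satisfy $w_{\mathrm r}^{\min}(k+j)\ge p_{\mathrm r}^{\min}$ so that the saturation below is well-defined. Saturated model, for $j=1,\dots,N_p$: $$\begin{aligned} 0&=\mathbf 1^{\mathsf T}p(k+j)+\mathbf 1^{\mathsf T}w_{\mathrm d}(k+j),\\ p_{\mathrm r}(k+j)&=\mathrm{sat}(p_{\mathrm r}^{\min},\,u_{\mathrm r}(k+j)+\chi_{\mathrm r}\rho(k+j),\,w_{\mathrm r}(k+j)),\\ p_{\mathrm t}(k+j)&=\delta_{\mathrm t}(k+j)\wedge\mathrm{sat}(p_{\mathrm t}^{\min},\,u_{\mathrm t}(k+j)+\chi_{\mathrm t}\rho(k+j),\,p_{\mathrm t}^{\max}),\\ \bar p_{\mathrm s}^{\min}(k+j)&=\max(p_{\mathrm s}^{\min},(x(k+j-1)-x^{\max})/\mathrm T_{\mathrm s}),\\ \bar p_{\mathrm s}^{\max}(k+j)&=\min(p_{\mathrm s}^{\max},(x(k+j-1)-x^{\min})/\mathrm T_{\mathrm s}),\\ p_{\mathrm s}(k+j)&=\mathrm{sat}(\bar p_{\mathrm s}^{\min}(k+j),\,u_{\mathrm s}(k+j)+\chi_{\mathrm s}\rho(k+j),\,\bar p_{\mathrm s}^{\max}(k+j)),\\ x(k+j)&=x(k+j-1)-\mathrm T_{\mathrm s}\,p_{\mathrm s}(k+j), \end{aligned}$$ with initial conditions $x(k)=x_{\mathrm s,0}$, $\delta_{\mathrm t}(k)=\delta_{\mathrm t,0}$. Feasibility. A control $(\boldsymbol\delta_{\mathrm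 t},\mathbf u)$ is admissible if $\boldsymbol\delta_{\mathrm t}\in\{0,1\}^{T\times N_p}$ and every column of $\mathbf u$ lies in $[u^{\min},u^{\max}]$. An admissible control is feasible for $\mathbf w$ if there exist $p(k+j),x(k+j),\rho(k+j)$, $j=1,\dots,N_p$, satisfying the saturated model with the given initial conditions; it is robustly feasible if it is feasible for every $\mathbf w\in[\mathbf w^{\min},\mathbf w^{\max}]$. Cost. With weights $C_{\mathrm t},C_{\mathrm{on}},C_{\mathrm{sw}}\in\mathbb R_{\ge0}^T$ and $C_{\mathrm s}\in\mathbb R_{\ge0}^S$, $$J(\mathbf p,\boldsymbol\delta_{\mathrm t},\delta_{\mathrm t}(k))=\sum_{j=1}^{N_p}\Big(C_{\mathrm t}^{\mathsf T}p_{\mathrm t}(k+j)+C_{\mathrm{on}}^{\mathsf T}\delta_{\mathrm t}(k+j)+C_{\mathrm{sw}}^{\mathsf T}|\delta_{\mathrm t}(k+j)-\delta_{\mathrm t}(k+j-1)|+C_{\mathrm s}^{\mathsf T}p_{\mathrm s}(k+j)\Big).$$ *)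

(* Defs.v *)
From mathcomp Require Export all_boot all_order all_algebra.
From mathcomp Require Export classical_sets reals.

Set Implicit Arguments.
Unset Strict Implicit.
Unset Printing Implicit Defensive.

Import Order.TTheory GRing.Theory Num.Theory.
Local Open Scope ring_scope.
Local Open Scope classical_set_scope.

Section Elementwise.
Context {R : realType}.

Definition mxle m n (A B : 'M[R]_(m, n)) : Prop := forall i j, A i j <= B i j.
Definition mxlt m n (A B : 'M[R]_(m, n)) : Prop := forall i j, A i j < B i j.

Definition mxbox m n (A B : 'M[R]_(m, n)) : set 'M[R]_(m, n) :=
  [set Z | mxle A Z /\ mxle Z B].

Definition gate (d : bool) (z : R) : R := if d then z else 0.

(* Meaningful only for a <= b. *)
Definition sat (a z b : R) : R :=
  if z < a then a else if z <= b then z else b.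

Definition is_max (A : set R) (c : R) : Prop := A c /\ ubound A c.

End Elementwise.

(* If the columns of M are the values at k+1, ..., k+N and v0 is the value at
   k, then [prev v0 M j] is the value one instant before that of column j:
   v0 for the first column, the preceding column of M otherwise. *)
Definition prev (V : Type) n N (v0 : 'cV[V]_n) (M : 'M[V]_(n, N)) (j : 'I_N) :
    'cV[V]_n :=
  col (widen_ord (leqnSn N) j) (row_mx v0 M).

(* Unit vectors are stacked as (conventional, storage, renewable), and
   'I_(nT + nS + nR) parses as 'I_((nT + nS) + nR); disturbances are stacked as
   (available renewable infeed, load). *)
Section Blocks.
Context {R : realType} {nT nS nR nD N : nat}.

Definition tpart (z : 'M[R]_(nT + nS + nR, N)) : 'M[R]_(nT, N) :=
  usubmx (usubmx z).
Definition spart (z : 'M[R]_(nT + nS + nR, N)) : 'M[R]_(nS, N) :=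
  dsubmx (usubmx z).
Definition rpart (z : 'M[R]_(nT + nS + nR, N)) : 'M[R]_(nR, N) := dsubmx z.

Definition wr (w : 'M[R]_(nR + nD, N)) : 'M[R]_(nR, N) := usubmx w.
Definition wd (w : 'M[R]_(nR + nD, N)) : 'M[R]_(nD, N) := dsubmx w.

End Blocks.

Record microgrid (R : realType) (nT nS nR : nat) := Microgrid {
  Ts : R;
  chit : 'cV[R]_nT;
  chis : 'cV[R]_nS;
  chir : 'cV[R]_nR;
  ptmin : 'cV[R]_nT;
  ptmax : 'cV[R]_nT;
  psmin : 'cV[R]_nS;
  psmax : 'cV[R]_nS;
  prmin : 'cV[R]_nR;
  xmin : 'cV[R]_nS;
  xmax : 'cV[R]_nS;
  umin : 'cV[R]_(nT + nS + nR);
  umax : 'cV[R]_(nT + nS + nR);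
  Ts_gt0 : 0 < Ts;
  chit_ge0 : mxle 0 chit;
  chis_ge0 : mxle 0 chis;
  chir_ge0 : mxle 0 chir;
  ptmin_ge0 : mxle 0 ptmin;
  ptmax_gt0 : mxlt 0 ptmax;
  ptmin_le_ptmax : mxle ptmin ptmax;
  psmin_lt0 : mxlt psmin 0;
  psmax_gt0 : mxlt 0 psmax;
  prmin_ge0 : mxle 0 prmin;
  xmin_ge0 : mxle 0 xmin;
  xmax_gt0 : mxlt 0 xmax;
  xmin_le_xmax : mxle xmin xmax;
  umin_le_umax : mxle umin umax
}.

Record cost_weights (R : realType) (nT nS : nat) := CostWeights {
  Ct : 'cV[R]_nT;
  Con : 'cV[R]_nT;
  Csw : 'cV[R]_nT;
  Cs : 'cV[R]_nS;
  Ct_ge0 : mxle 0 Ct;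
  Con_ge0 : mxle 0 Con;
  Csw_ge0 : mxle 0 Csw;
  Cs_ge0 : mxle 0 Cs
}.

Section Model.
Context {R : realType} {nT nS nR nD Np : nat}.
Variable G : microgrid R nT nS nR.

Record disturbance_bounds (wmin wmax : 'M[R]_(nR + nD, Np)) : Prop := {
  wmin_le_wmax : mxle wmin wmax;
  wrmin_ge0 : mxle 0 (wr wmin);
  wrmax_ge0 : mxle 0 (wr wmax);
  wdmin_le0 : mxle (wd wmin) 0;
  wdmax_le0 : mxle (wd wmax) 0;
  prmin_le_wrmin : forall i j, prmin G i 0 <= wr wmin i j
}.

Definition psbarmin (xprev : 'cV[R]_nS) (i : 'I_nS) : R :=
  Num.max (psmin G i 0) ((xprev i 0 - xmax G i 0) / Ts G).
Definition psbarmax (xprev : 'cV[R]_nS) (i : 'I_nS) : R :=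
  Num.min (psmax G i 0) ((xprev i 0 - xmin G i 0) / Ts G).

Record saturated_model (xs0 : 'cV[R]_nS)
    (deltat : 'M[bool]_(nT, Np)) (u : 'M[R]_(nT + nS + nR, Np))
    (w : 'M[R]_(nR + nD, Np))
    (p : 'M[R]_(nT + nS + nR, Np)) (x : 'M[R]_(nS, Np)) (rho : 'rV[R]_Np) :
    Prop := {
  power_balance : forall j, 0 = \sum_i p i j + \sum_i wd w i j;
  renewable_power : forall i j,
    rpart p i j =
      sat (prmin G i 0) (rpart u i j + chir G i 0 * rho 0 j) (wr w i j);
  conventional_power : forall i j,
    tpart p i j =
      gate (deltat i j)
        (sat (ptmin G i 0) (tpart u i j + chit G i 0 * rho 0 j) (ptmax G i 0));
  storage_power : forall i j,
    spart p i j =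
      sat (psbarmin (prev xs0 x j) i)
          (spart u i j + chis G i 0 * rho 0 j)
          (psbarmax (prev xs0 x j) i);
  storage_energy : forall i j,
    x i j = prev xs0 x j i 0 - Ts G * spart p i j
}.

Definition resulting_power (xs0 : 'cV[R]_nS)
    (deltat : 'M[bool]_(nT, Np)) (u : 'M[R]_(nT + nS + nR, Np))
    (w : 'M[R]_(nR + nD, Np)) : set 'M[R]_(nT + nS + nR, Np) :=
  [set p | exists x rho, saturated_model xs0 deltat u w p x rho].

(* Switch statuses are boolean matrices, so only u is constrained. *)
Definition admissible (deltat : 'M[bool]_(nT, Np))
    (u : 'M[R]_(nT + nS + nR, Np)) : Prop :=
  forall j, mxbox (umin G) (umax G) (col j u).

Definition feasible (xs0 : 'cV[R]_nS)
    (deltat : 'M[bool]_(nT, Np)) (u : 'M[R]_(nT + nS + nR, Np))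
    (w : 'M[R]_(nR + nD, Np)) : Prop :=
  admissible deltat u /\ exists p, resulting_power xs0 deltat u w p.

Definition robustly_feasible (wmin wmax : 'M[R]_(nR + nD, Np))
    (xs0 : 'cV[R]_nS)
    (deltat : 'M[bool]_(nT, Np)) (u : 'M[R]_(nT + nS + nR, Np)) : Prop :=
  admissible deltat u /\
  forall w, mxbox wmin wmax w -> feasible xs0 deltat u w.

Definition operation_cost (C : cost_weights R nT nS)
    (p : 'M[R]_(nT + nS + nR, Np)) (deltat : 'M[bool]_(nT, Np))
    (deltat0 : 'cV[bool]_nT) : R :=
  \sum_(j < Np)
    (\sum_i Ct C i 0 * tpart p i j
     + \sum_i Con C i 0 * (deltat i j)%:R
     + \sum_i Csw C i 0 * `|(deltat i j)%:R - (prev deltat0 deltat j i 0)%:R|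
     + \sum_i Cs C i 0 * spart p i j).

End Model.

(* Main.v *)
Require Import Defs.
From mathcomp Require Import ring lra.

Set Implicit Arguments.
Unset Strict Implicit.
Unset Printing Implicit Defensive.

Import Order.TTheory GRing.Theory Num.Theory.
Local Open Scope ring_scope.
Local Open Scope classical_set_scope.

(** Two closed-loop runs are compared step by step.  Write [rho], [rho'] for
    their frequency variables at a step and suppose that the second run enters
    the step with at least as much stored energy and sees the larger
    disturbance, that is, more available infeed and less consumption ([wd] is
    non-positive).

    Every unit power is nondecreasing in [rho], in the stored energy and in the
    available infeed ([power_mono]).  Hence if [rho <= rho'], the second run
    produces at least as much in every unit; but it has to cover a load that is
    not larger, so power balance forces all powers to agree
    ([power_eq_or_frequency_le]).  Otherwise [rho' < rho], and the conventional
    units of the second run produce no more.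

    Either way the second run also leaves the step with at least as much stored
    energy.  This is clear when the powers agree.  When [rho' <= rho] it is
    because the extra energy in the storage raises the discharged power by at
    most the amount that would consume it ([next_energy_mono]).  By induction
    the order of the stored energies persists over the horizon ([energy_le]).

    So the larger disturbance gives the smaller conventional powers at each
    step ([conventional_power_le]).  Storage powers need not be ordered step by
    step, but their sum over the horizon telescopes to the energy lost, divided
    by [Ts], and the second run ends with at least as much energy
    ([sum_storage_power_le]); since the weight [Cs] is constant in time, this
    sum is all that enters the cost.  The switching terms do not depend on the
    disturbance.
    Applying the dichotomy in both directions with equal disturbances yields
    uniqueness of the powers ([resulting_power_unique]). *)

(** * Monotonicity of saturation *)

Section Saturation.
Context {R : realType}.
Implicit Types a b z d : R.

Lemma satE a z b : a <= b -> sat a z b = Num.max a (Num.min z b).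
Proof.
move=> ab; rewrite /sat.
have [za|az] := ltP z a.
  by apply/esym/max_idPl; rewrite ge_min (ltW za).
by have [zb|bz] := leP z b; apply/esym/max_idPr.
Qed.

Lemma sat_ge a z b : a <= b -> a <= sat a z b.
Proof. by move=> ab; rewrite satE// le_max lexx. Qed.

Lemma sat_le a z b : a <= b -> sat a z b <= b.
Proof. by move=> ab; rewrite satE// ge_max ab ge_min lexx orbT. Qed.

Lemma sat_mono a z b a' z' b' : a <= b -> a' <= b' ->
  a <= a' -> z <= z' -> b <= b' -> sat a z b <= sat a' z' b'.
Proof.
move=> ab ab' aa zz bb; rewrite !satE// le_max2// le_min2//.
Qed.

Lemma sat_shift a z b d : sat (a + d) (z + d) (b + d) = sat a z b + d.
Proof. by rewrite /sat ltrD2r lerD2r; case: ifP => // _; case: ifP. Qed.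

Lemma gate_mono (s : bool) z z' : z <= z' -> gate s z <= gate s z'.
Proof. by case: s. Qed.

End Saturation.

(** * Stored energy along the horizon *)

(** The energy trajectory indexed by the number of elapsed steps, starting from
    the initial value; it turns [prev] into a shift of a natural index. *)
Definition energy (R : realType) nS Np (xs0 : 'cV[R]_nS) (x : 'M[R]_(nS, Np))
    (k : nat) : 'cV[R]_nS :=
  col (n := (1 + Np)%N) (inord k : 'I_Np.+1) (row_mx xs0 x).

Section Energy.
Context {R : realType} {nS Np : nat}.
Variables (xs0 : 'cV[R]_nS) (x : 'M[R]_(nS, Np)).

Lemma energy0 : energy xs0 x 0 = xs0.
Proof.
apply/colP => i; rewrite mxE.
have -> : (inord 0 : 'I_Np.+1) = lshift Np (ord0 : 'I_1).
  by apply: val_inj; rewrite /= inordK.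
by rewrite row_mxEl.
Qed.

Lemma energyS (j : 'I_Np) i : energy xs0 x j.+1 i 0 = x i j.
Proof.
rewrite mxE.
have -> : (inord j.+1 : 'I_Np.+1) = rshift 1 j.
  by apply: val_inj; rewrite /= inordK// ltnS ltn_ord.
by rewrite row_mxEr.
Qed.

Lemma prevE (j : 'I_Np) : prev xs0 x j = energy xs0 x j.
Proof.
rewrite /prev /energy; congr col; apply: val_inj => /=.
by rewrite inordK// ltnW// ltnS ltn_ord.
Qed.

End Energy.

(** * One step of the storage dynamics *)

Section Model.
Context {R : realType} {nT nS nR nD Np : nat}.
Variable G : microgrid R nT nS nR.
Implicit Types (e : 'cV[R]_nS) (x : 'M[R]_(nS, Np)) (w : 'M[R]_(nR + nD, Np))
  (p : 'M[R]_(nT + nS + nR, Np)) (rho : 'rV[R]_Np).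

Lemma psbar_le e i : mxbox (xmin G) (xmax G) e ->
  psbarmin G e i <= psbarmax G e i.
Proof.
move=> [lo hi]; have T0 := Ts_gt0 G.
have := psmin_lt0 G i 0; have := psmax_gt0 G i 0; rewrite !mxE => pM pm.
have lo' : 0 <= (e i 0 - xmin G i 0) / Ts G.
  by rewrite divr_ge0 ?subr_ge0 ?(ltW T0)//; exact: lo.
have hi' : (e i 0 - xmax G i 0) / Ts G <= 0.
  by rewrite pmulr_lle0 ?invr_gt0// subr_le0; exact: hi.
rewrite /psbarmin /psbarmax ge_max !le_min.
by apply/andP; split; apply/andP; split; lra.
Qed.

Lemma psbarmin_mono e e' i : mxle e e' -> psbarmin G e i <= psbarmin G e' i.
Proof.
move=> ee; rewrite /psbarmin le_max2//.
by rewrite ler_pM2r ?invr_gt0 ?Ts_gt0// lerD2r.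
Qed.

Lemma psbarmax_mono e e' i : mxle e e' -> psbarmax G e i <= psbarmax G e' i.
Proof.
move=> ee; rewrite /psbarmax le_min2//.
by rewrite ler_pM2r ?invr_gt0 ?Ts_gt0// lerD2r.
Qed.

(** The state-dependent terms of the dynamic power limits are the powers that
    bring the energy to a face of its box in one step. *)
Lemma next_energy_in_box e i v : mxbox (xmin G) (xmax G) e ->
  let e' := e i 0 - Ts G * sat (psbarmin G e i) v (psbarmax G e i) in
  xmin G i 0 <= e' <= xmax G i 0.
Proof.
move=> eb; have T0 := Ts_gt0 G; have ab := psbar_le i eb.
have := sat_ge v ab; have := sat_le v ab; set s := sat _ _ _.
rewrite {1}/psbarmax {1}/psbarmin le_min ge_max ler_pdivlMr// ler_pdivrMr//.
by move=> /andP[_ h1] /andP[_ h2] /=; apply/andP; split; lra.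
Qed.

(** Raising the energy by [Ts * d] raises both power limits by at most [d], so
    the extra discharge over one step is at most the extra energy. *)
Lemma next_energy_mono e e' i v v' :
  mxbox (xmin G) (xmax G) e -> mxbox (xmin G) (xmax G) e' ->
  mxle e e' -> v' <= v ->
  e i 0 - Ts G * sat (psbarmin G e i) v (psbarmax G e i) <=
  e' i 0 - Ts G * sat (psbarmin G e' i) v' (psbarmax G e' i).
Proof.
move=> eb eb' ee vv; have T0 := Ts_gt0 G.
pose d := (e' i 0 - e i 0) / Ts G.
have d0 : 0 <= d by rewrite divr_ge0 ?(ltW T0)// subr_ge0.
have Td : Ts G * d = e' i 0 - e i 0 by rewrite mulrC divfK ?gt_eqF.
have shift c : (e' i 0 - c) / Ts G = (e i 0 - c) / Ts G + d.
  by rewrite -mulrDl; congr (_ / _); ring.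
have : sat (psbarmin G e' i) v' (psbarmax G e' i) <=
       sat (psbarmin G e i) v (psbarmax G e i) + d.
  rewrite -sat_shift; apply: sat_mono; first exact: psbar_le.
  - by rewrite lerD2r psbar_le.
  - by rewrite /psbarmin shift addr_maxl le_max2// lerDl.
  - by lra.
  - by rewrite /psbarmax shift addr_minl le_min2// lerDl.
by rewrite -(ler_pM2l T0) mulrDr Td; lra.
Qed.

(** * Comparison of two runs *)

Section Runs.
Variables (xs0 : 'cV[R]_nS) (deltat : 'M[bool]_(nT, Np))
  (u : 'M[R]_(nT + nS + nR, Np)).
Hypothesis xs0_box : mxbox (xmin G) (xmax G) xs0.

Lemma energy_in_box w p x rho k : saturated_model G xs0 deltat u w p x rho ->
  (k <= Np)%N -> mxbox (xmin G) (xmax G) (energy xs0 x k).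
Proof.
move=> M; elim: k => [|k IH] kN; first by rewrite energy0.
have eb := IH (ltnW kN).
suff H i : xmin G i 0 <= energy xs0 x k.+1 i 0 <= xmax G i 0.
  by split=> i j; rewrite (ord1 j); have /andP[] := H i.
rewrite (energyS xs0 x (Ordinal kN)) (storage_energy M) (storage_power M) prevE.
exact: next_energy_in_box.
Qed.

Lemma unit_block_ind (P : 'I_(nT + nS + nR) -> Prop) :
  (forall i, P (lshift nR (lshift nS i))) ->
  (forall i, P (lshift nR (rshift nT i))) ->
  (forall i, P (rshift (nT + nS) i)) -> forall i, P i.
Proof.
move=> Pt Ps Pr i; case: (split_ordP i) => k -> //.
by case: (split_ordP k) => l ->.
Qed.

Section TwoRuns.
Variables (w w' : 'M[R]_(nR + nD, Np)) (p p' : 'M[R]_(nT + nS + nR, Np))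
  (x x' : 'M[R]_(nS, Np)) (rho rho' : 'rV[R]_Np).
Hypotheses (run : saturated_model G xs0 deltat u w p x rho)
  (run' : saturated_model G xs0 deltat u w' p' x' rho')
  (infeed : forall i j, prmin G i 0 <= wr w i j)
  (ww' : mxle w w').

Lemma wr_le : mxle (wr w) (wr w').
Proof. by move=> i j; rewrite !mxE. Qed.

Lemma conventional_power_mono i j : rho 0 j <= rho' 0 j ->
  tpart p i j <= tpart p' i j.
Proof.
move=> rr; rewrite (conventional_power run) (conventional_power run').
apply/gate_mono/sat_mono => //; do ?exact: ptmin_le_ptmax.
by rewrite lerD2l ler_wpM2l//; have := chit_ge0 G i 0; rewrite mxE.
Qed.

Lemma storage_power_mono i j : rho 0 j <= rho' 0 j ->
  mxle (energy xs0 x j) (energy xs0 x' j) -> spart p i j <= spart p' i j.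
Proof.
move=> rr ee; rewrite (storage_power run) (storage_power run') !prevE.
apply: sat_mono.
- exact/psbar_le/(energy_in_box run)/ltnW.
- exact/psbar_le/(energy_in_box run')/ltnW.
- exact: psbarmin_mono.
- by rewrite lerD2l ler_wpM2l//; have := chis_ge0 G i 0; rewrite mxE.
- exact: psbarmax_mono.
Qed.

Lemma renewable_power_mono i j : rho 0 j <= rho' 0 j ->
  rpart p i j <= rpart p' i j.
Proof.
move=> rr; rewrite (renewable_power run) (renewable_power run').
have wr_ij := wr_le i j.
apply: sat_mono => //; first exact: le_trans wr_ij.
by rewrite lerD2l ler_wpM2l//; have := chir_ge0 G i 0; rewrite mxE.
Qed.

Lemma power_mono i j : rho 0 j <= rho' 0 j ->
  mxle (energy xs0 x j) (energy xs0 x' j) -> p i j <= p' i j.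
Proof.
move=> rr ee; elim/unit_block_ind: i => i.
- by have := conventional_power_mono i rr; rewrite !mxE.
- by have := storage_power_mono i rr ee; rewrite !mxE.
- by have := renewable_power_mono i rr; rewrite !mxE.
Qed.

(** A larger frequency variable would raise all powers, while the larger
    disturbance lowers the load they add up to. *)
Lemma power_eq_or_frequency_le (j : 'I_Np) :
  mxle (energy xs0 x j) (energy xs0 x' j) ->
  (forall i, p i j = p' i j) \/ rho' 0 j <= rho 0 j.
Proof.
move=> ee; have [rr|/ltW rr] := leP (rho' 0 j) (rho 0 j); [by right|left].
have pp i : p i j <= p' i j by exact: power_mono.
have load : \sum_i wd w i j <= \sum_i wd w' i j.
  by apply: ler_sum => i _; rewrite !mxE.
have sum0 : \sum_i (p' i j - p i j) = 0.
  have := power_balance run j; have := power_balance run' j.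
  have : \sum_i p i j <= \sum_i p' i j by exact: ler_sum.
  by rewrite sumrB; lra.
move=> i; apply/esym/eqP; rewrite -subr_eq0; apply/eqP.
by apply: (psumr_eq0P _ sum0) => // k _; rewrite subr_ge0.
Qed.

Lemma energy_le k : (k <= Np)%N -> mxle (energy xs0 x k) (energy xs0 x' k).
Proof.
elim: k => [|k IH] kN; first by rewrite !energy0.
pose j := Ordinal kN; have ee : mxle (energy xs0 x j) (energy xs0 x' j).
  exact/IH/ltnW.
move=> i i0; rewrite (ord1 i0) !(energyS xs0 _ j).
rewrite (storage_energy run) (storage_energy run') !prevE.
have [pp|rr] := power_eq_or_frequency_le ee.
  by rewrite lerB ?ee// !mxE pp.
rewrite (storage_power run) (storage_power run') !prevE.
apply: next_energy_mono => //.
- exact/(energy_in_box run)/ltnW.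
- exact/(energy_in_box run')/ltnW.
- by rewrite lerD2l ler_wpM2l//; have := chis_ge0 G i 0; rewrite mxE.
Qed.

End TwoRuns.

Lemma conventional_power_le w w' p p' x x' rho rho' i j :
  saturated_model G xs0 deltat u w p x rho ->
  saturated_model G xs0 deltat u w' p' x' rho' ->
  (forall i j, prmin G i 0 <= wr w i j) -> mxle w w' ->
  tpart p' i j <= tpart p i j.
Proof.
move=> run run' inf ww; have jN := ltnW (ltn_ord j).
have ee := energy_le run run' inf ww jN.
have [pp|rr] := power_eq_or_frequency_le run run' inf ww ee.
  by rewrite !mxE pp.
exact: (conventional_power_mono run' run).
Qed.

Lemma sum_storage_power w p x rho i :
  saturated_model G xs0 deltat u w p x rho ->
  Ts G * (\sum_j spart p i j) = xs0 i 0 - energy xs0 x Np i 0.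
Proof.
move=> M; rewrite mulr_sumr.
transitivity (\sum_(0 <= k < Np)
    (energy xs0 x k i 0 - energy xs0 x k.+1 i 0)); last first.
  rewrite (telescope_sumr_eq (fun k => - energy xs0 x k i 0)) //.
    by rewrite energy0; ring.
  by move=> k _; ring.
rewrite big_mkord; apply: eq_bigr => j _.
by rewrite energyS (storage_energy M) prevE; ring.
Qed.

Lemma sum_storage_power_le w w' p p' x x' rho rho' i :
  saturated_model G xs0 deltat u w p x rho ->
  saturated_model G xs0 deltat u w' p' x' rho' ->
  (forall i j, prmin G i 0 <= wr w i j) -> mxle w w' ->
  \sum_j spart p' i j <= \sum_j spart p i j.
Proof.
move=> run run' inf ww; rewrite -(ler_pM2l (Ts_gt0 G)).
rewrite (sum_storage_power i run) (sum_storage_power i run').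
by rewrite lerD2l lerN2; exact: (energy_le run run').
Qed.

Lemma operation_cost_le (C : cost_weights R nT nS) deltat0
    w w' p p' x x' rho rho' :
  saturated_model G xs0 deltat u w p x rho ->
  saturated_model G xs0 deltat u w' p' x' rho' ->
  (forall i j, prmin G i 0 <= wr w i j) -> mxle w w' ->
  operation_cost C p' deltat deltat0 <= operation_cost C p deltat deltat0.
Proof.
move=> run run' inf ww; rewrite /operation_cost !big_split /=.
apply: lerD; first do 2 apply: lerD => //.
  apply: ler_sum => j _; apply: ler_sum => i _; rewrite ler_wpM2l//.
    by have := Ct_ge0 C i 0; rewrite mxE.
  exact: (conventional_power_le _ _ run run').
rewrite exchange_big [leRHS]exchange_big; apply: ler_sum => i _.
rewrite -!mulr_sumr ler_wpM2l//.
  by have := Cs_ge0 C i 0; rewrite mxE.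
exact: (sum_storage_power_le _ run run').
Qed.

(** Each run dominates the other in stored energy, so the energies agree; at
    each step either the powers agree or so do the frequency variables, and
    then again the powers. *)
Lemma resulting_power_unique w p p' :
  (forall i j, prmin G i 0 <= wr w i j) ->
  resulting_power G xs0 deltat u w p -> resulting_power G xs0 deltat u w p' ->
  p = p'.
Proof.
move=> inf [x [rho run]] [x' [rho' run']]; apply/matrixP => i j.
have ww : mxle w w by [].
have jN := ltnW (ltn_ord j).
have ee := energy_le run run' inf ww jN.
have ee' := energy_le run' run inf ww jN.
have [->//|rr] := power_eq_or_frequency_le run run' inf ww ee.
have [->//|rr'] := power_eq_or_frequency_le run' run inf ww ee'.
by apply/le_anti/andP; split; [apply: (power_mono run run')|
  apply: (power_mono run' run)].
Qed.

End Runs.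
End Model.

Theorem theorem2 (R : realType) (nT nS nR nD Np : nat)
    (G : microgrid R nT nS nR) (C : cost_weights R nT nS)
    (wmin wmax : 'M[R]_(nR + nD, Np)) (hw : disturbance_bounds G wmin wmax)
    (xs0 : 'cV[R]_nS) (hxs0 : mxbox (xmin G) (xmax G) xs0)
    (deltat0 : 'cV[bool]_nT)
    (deltat : 'M[bool]_(nT, Np)) (u : 'M[R]_(nT + nS + nR, Np))
    (hfeas : robustly_feasible G wmin wmax xs0 deltat u) :
  (forall w, mxbox wmin wmax w ->
     exists! p, resulting_power G xs0 deltat u w p) /\
  (forall pmin, resulting_power G xs0 deltat u wmin pmin ->
     is_max [set c | exists w p, [/\ mxbox wmin wmax w,
                                     resulting_power G xs0 deltat u w p &
                                     c = operation_cost C p deltat deltat0]]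
            (operation_cost C pmin deltat deltat0)).
Proof.
have inf w : mxle wmin w -> forall i j, prmin G i 0 <= wr w i j.
  move=> ww i j; apply: le_trans (prmin_le_wrmin hw i j) _.
  exact: wr_le ww i j.
split=> [w wb|pmin Hpmin].
  have [_ [p Hp]] := hfeas.2 w wb.
  exists p; split=> // p' Hp'.
  exact: (resulting_power_unique hxs0 (inf _ wb.1) Hp Hp').
split.
  by exists wmin, pmin; split=> //; split=> //; exact: wmin_le_wmax hw.
move=> c [w [p [[ww _] [x' [rho' run']] ->]]].
have [x [rho run]] := Hpmin.
have inf_min : forall i j, prmin G i 0 <= wr wmin i j by exact: inf.
exact: (operation_cost_le hxs0 C deltat0 run run' inf_min ww).
Qed.
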